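(* Every locating code $S$ in $\mathrm{C}_\infty(1,3)$ has density $\rho(S)\ge 1/3$.
   Context: The infinite circulant graph $\mathrm{C}_\infty(1,3)$ has vertex set $\mathbb{Z}$ and edges $xy$ with $|x-y|\in\{1,3\}$. For $u\in\mathbb{Z}$, $N[u]=\{u,u\pm1,u\pm3\}$ is its closed neighbourhood, and for $S\subseteq\mathbb{Z}$, $S_u=N[u]\cap S$. A set $S\subseteq\mathbb{Z}$ is a locating code if the sets $S_u$, $u\in\mathbb{Z}\setminus S$, are all nonempty and pairwise distinct. The density of $S\subseteq\mathbb{Z}$ is $\rho(S)=\limsup_{N\to\infty}\frac{|S\cap[-N,N]|}{2N+1}$. *)

(* Defs.v *)
From mathcomp Require Import all_boot all_order all_algebra finmap zify.
From mathcomp Require Import mathcomp_extra boolp classical_sets functions.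
From mathcomp Require Import cardinality set_interval.
From mathcomp Require Import reals ereal topology normedtype sequences.

Set Implicit Arguments.
Unset Strict Implicit.
Unset Printing Implicit Defensive.

Import Order.TTheory GRing.Theory Num.Theory.

Local Open Scope classical_set_scope.
Local Open Scope ring_scope.

(* Adjacency in the infinite circulant graph C_oo(1,3) on the integers. *)
Definition adj13 (x y : int) : Prop := `|x - y| = 1 \/ `|x - y| = 3.

Definition closed_nbhd (u : int) : set int := [set v | v = u \/ adj13 u v].

Lemma closed_nbhdE (u : int) :
  closed_nbhd u = [set u; u - 1; u + 1; u - 3; u + 3].
Proof. by apply/seteqP; split=> v; rewrite /closed_nbhd /adj13 /=; lia. Qed.

(* The trace S_u of S on N[u]. *)
Definition trace (S : set int) (u : int) : set int := closed_nbhd u `&` S.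

Definition locating_code (S : set int) : Prop :=
  (forall u, ~ S u -> trace S u !=set0) /\
  (forall u v, ~ S u -> ~ S v -> u <> v -> trace S u <> trace S v).

Definition window (N : nat) : set int := `[- N%:Z, N%:Z].

(* [fset_set] sends infinite sets to [fset0]; by this lemma that never happens
   in [density]. *)
Lemma finite_setI_window (S : set int) (N : nat) : finite_set (S `&` window N).
Proof.
apply: (@sub_finite_set _ _ ((fun i : nat => i%:Z - N%:Z) @` `I_(N + N).+1)).
  move=> x [_]; rewrite /window /= in_itv /= => /andP[lx xu].
  by exists (absz (x + N%:Z)) => /=; lia.
exact/finite_image/finite_II.
Qed.

(* The upper limit is taken in the extended reals, where it always exists. *)
Definition density (R : realType) (S : set int) : \bar R :=
  limn_esup (fun N : nat =>
    ((#|` fset_set (S `&` window N)|)%:R / (2 * N + 1)%N%:R : R)%:E).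

(* Main.v *)
Require Import Defs.
From mathcomp Require Import all_boot all_order all_algebra.
From mathcomp Require Import classical_sets reals ereal.
From mathcomp Require Import finmap zify lra boolp cardinality.
From mathcomp Require Import normedtype sequences.

(** If S contains neither u, v nor any vertex of the symmetric difference of
    N[u] and N[v], then S_u = S_v. Hence every locating code meets N[u],
    {u-3, u, u+2, u+5} (for v = u + 2) and
    {u-3, u-1, u, u+4, u+5, u+7} (for v = u + 4). The translates of these three
    patterns inside twelve consecutive integers already force one of the initial
    blocks of length 3, 6, 9 or 12 to have density at least 1/3. Cutting off
    such blocks greedily from left to right, an interval of length L contains at
    least (L - 11) / 3 codewords. *)

Import Order.TTheory GRing.Theory Num.Theory numFieldNormedType.Exports.

Lemma dense_initial_block (x : nat -> bool) :
  (forall k, has x [:: k; k.+2; k.+3; k.+4; k.+2.+4]) ->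
  (forall k, has x [:: k; k.+3; k.+1.+4; k.+4.+4]) ->
  (forall k, has x [:: k; k.+2; k.+3; k.+3.+4; k.+4.+4; k.+2.+4.+4]) ->
  exists2 k, 0 < k <= 4 & k <= \sum_(i < 3 * k) x i.
Proof.
move=> D A B.
suff: [|| 1 <= \sum_(i < 3) x i, 2 <= \sum_(i < 6) x i,
          3 <= \sum_(i < 9) x i | 4 <= \sum_(i < 12) x i].
  by case/or4P=> ?; [exists 1|exists 2|exists 3|exists 4].
(* These are exactly the translates contained in positions 0 to 11, which leaves a finite check on
   twelve booleans. *)
move: (D 0) (D 1) (D 2) (D 3) (D 4) (D 5) (A 0) (A 1) (A 2) (A 3) (B 0) (B 1).
rewrite !big_ord_recr !big_ord0 /=; clear D A B.
by do 12?[match goal with |- context [x ?i] => case: (x i) => //= end].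
Qed.

Lemma sum_greedy_blocks (x : nat -> bool) :
  (forall n, exists2 k, 0 < k <= 4 & k <= \sum_(i < 3 * k) x (n + i)) ->
  forall L n, L <= 3 * \sum_(i < L) x (n + i) + 11.
Proof.
move=> block L; have [m] := ubnP L; elim: m L => // m IH L ltLm n.
(* The slack 11 absorbs a remainder shorter than 12; otherwise any block, of length [3 * k <= 12],
   fits. *)
have [?|L12] := ltnP L 12; first by lia.
have [k k14 sumk] := block n.
have LE : L = 3 * k + (L - 3 * k) by lia.
move: (L - 3 * k) LE => r LE; subst L.
have := IH r ltac:(lia) (n + 3 * k).
rewrite big_split_ord /=.
under [X in _ -> _ <= 3 * (_ + X) + 11]eq_bigr do rewrite addnA.
move: sumk; move: (\sum_(i < 3 * k) _) (\sum_(i < r) _) => s t; lia.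
Qed.

Local Open Scope classical_set_scope.
Local Open Scope ring_scope.

Lemma locating_code_dominates (S : set int) (u : int) : locating_code S ->
  exists2 z, S z & closed_nbhd u z.
Proof.
move=> [dom _]; have [Su|/dom[z [Nz Sz]]] := pselect (S u); last by exists z.
by exists u => //; left.
Qed.

(** The cases [z = u] and [z = v] arise because traces are compared only at vertices outside [S]. *)
Lemma locating_code_separates (S : set int) (u v : int) : locating_code S ->
  u <> v -> exists2 z, S z &
    [\/ z = u, z = v | (closed_nbhd u z <-> ~ closed_nbhd v z)].
Proof.
move=> [_ sep] uv; apply: contrapT => none.
have noneE z : S z ->
    ~ [\/ z = u, z = v | (closed_nbhd u z <-> ~ closed_nbhd v z)].
  by move=> Sz zP; apply: none; exists z.
apply: (sep u v) => //.
- by move=> /noneE; apply; constructor 1.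
- by move=> /noneE; apply; constructor 2.
apply/seteqP; split=> z [Nz Sz]; split=> //; apply: contrapT => nN;
  by apply: (noneE _ Sz); constructor 3.
Qed.

Lemma locating_code_count (S : set int) (a : int) (L : nat) :
  locating_code S -> (L <= 3 * \sum_(i < L) `[< S (a + i%:Z)%R >] + 11)%N.
Proof.
move=> hS; apply: (@sum_greedy_blocks (fun i => `[< S (a + i%:Z) >]) _ L 0).
(* The bound [a + n%:Z <= z] makes [absz] return the true offset of [z] from [a + n]. *)
move=> n; have hasS z (s : seq nat) : S z -> absz (z - a - n%:Z)%R \in s ->
    a + n%:Z <= z -> has (fun i => `[< S (a + (n + i)%N%:Z) >]) s.
  move=> Sz zs anz; apply/hasP; exists (absz (z - a - n%:Z)%R) => //.
  by apply/asboolP; rewrite (_ : a + _ = z) //; lia.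
(* With the shift by 3, the leftmost vertex [u - 3] of each pattern has offset [k]. *)
apply: (@dense_initial_block (fun i => `[< S (a + (n + i)%N%:Z) >])) => k;
  pose u := a + n%:Z + k%:Z + 3.
- have [z Sz zN] := locating_code_dominates S u hS.
  rewrite /closed_nbhd /adj13 /= in zN.
  by apply: (hasS _ _ Sz); rewrite ?inE; lia.
- have [|z Sz zN] := locating_code_separates S u (u + 2) hS; first by lia.
  rewrite /closed_nbhd /adj13 /= in zN.
  by apply: (hasS _ _ Sz); rewrite ?inE; case: zN; lia.
- have [|z Sz zN] := locating_code_separates S u (u + 4) hS; first by lia.
  rewrite /closed_nbhd /adj13 /= in zN.
  by apply: (hasS _ _ Sz); rewrite ?inE; case: zN; lia.
Qed.

Lemma sum_le_card_window (S : set int) (N : nat) :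
  (\sum_(i < 2 * N + 1) `[< S (- N%:Z + i%:Z)%R >] <=
   #|` fset_set (S `&` window N)|)%N.
Proof.
(* Distinct offsets from [- N] give distinct codewords, so [s] is duplicate-free. *)
pose s := [seq - N%:Z + i%:Z | i <- index_iota 0 (2 * N + 1)
                             & `[< S (- N%:Z + i%:Z) >]].
have -> : (\sum_(i < 2 * N + 1) `[< S (- N%:Z + i%:Z)%R >] = size s)%N.
  rewrite size_map size_filter -sum1_count [RHS]big_mkcond big_mkord.
  by apply: eq_bigr => i _; case: asboolP.
apply: uniq_leq_size => [|z].
  by rewrite map_inj_uniq ?filter_uniq ?iota_uniq // => i j; lia.
move=> /mapP[i]; rewrite mem_filter mem_index_iota => /andP[/asboolP Si iN] ->.
rewrite in_fset_set; last exact: finite_setI_window.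
by apply/mem_set; split=> //; rewrite /window /= in_itv /=; lia.
Qed.

(** The upper limit is an infimum of suprema over sets [V] of the filter; each supremum bounds [v]
    eventually, hence bounds [l]. *)
Lemma limn_esup_ge_cvg (R : realType) (u v : nat -> \bar R) (l : \bar R) :
  v @ \oo --> l -> (forall n, (v n <= u n)%E) -> (l <= limn_esup u)%E.
Proof.
move=> vl vu; apply: le_ereal_inf_tmp => _ [V Voo <-].
apply: (cvge_le _ vl); apply: filterS Voo => n Vn.
by apply: le_trans (vu n) _; apply: ereal_sup_ubound; exists n.
Qed.

Theorem theorem2 (R : realType) (S : set int) (hS : locating_code S) :
  ((1 / 3 : R)%:E <= density R S)%E.
Proof.
apply: (@limn_esup_ge_cvg _ _ (fun n => (1 / 3 - 4 * harmonic n)%:E)).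
  apply: cvg_EFin; first exact: nearW.
  rewrite -[X in _ --> X]subr0 -[X in _ - X](mulr0 4).
  apply: cvgB; first exact: cvg_cst.
  by apply: cvgM; [exact: cvg_cst|exact: cvg_harmonic].
move=> n; rewrite lee_fin.
have := leq_trans (locating_code_count S (- n%:Z) (2 * n + 1) hS)
  (leq_add (leq_mul (leqnn 3) (sum_le_card_window S n)) (leqnn 11)).
set c := #|` _|; rewrite -(ler_nat R) natrD [X in _ <= X]natrD !natrM => count.
rewrite ler_pdivlMr; last by rewrite ltr_wpDl // mulr_ge0.
have inv : n.+1%:R^-1 * (n%:R + 1) = 1 :> R.
  by rewrite natr1 mulVf // pnatr_eq0.
have : n.+1%:R^-1 <= 1 :> R by rewrite invf_le1 ?ltr0n // ler1n.
(* With [h = 1 / (n + 1)], [4 * h * (2 * n + 1) = 8 - 4 * h >= 4], which covers the loss [11 / 3] in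
   the count. *)
move: inv count; rewrite /harmonic /=.
move: n.+1%:R^-1 n%:R c%:R => h t d; lra.
Qed.
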